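(* Every recursive language $L$ has a competing-prover interactive proof system in which both provers are deterministic, the verifier is a probabilistic finite automaton (constant-space probabilistic verifier) that halts with probability 1, P0 displays zero information to P1 (P1 sees none of P0's messages), and P1 displays complete information to P0 (P0 sees all of P1's messages).
   Context: A competing-prover interactive proof system for a language $L$ consists of a probabilistic verifier $V$ that reads the input string and conducts a two-way conversation with two provers P1 and P0: $V$ may send messages (visible to both provers) and reads symbols written by P1 and by P0. Here the provers are deterministic, i.e. each is an arbitrary (not necessarily computable) function that determines its next symbol from the input string and the part of the communication it is allowed to see (all of $V$'s messages, its own messages, and, for P0, all of P1's messages; P1 does not see P0's messages). $V$ ends in an accepting or rejecting halting state. The system has error probability $\varepsilon < \frac12$ if (1) there is a prover P1 such that for every $w \in L$ and every prover P0, $V$ accepts $w$ with probability at least $1-\varepsilon$, and (2) for every prover P1 there exists a prover P0 such that for every $w \notin L$, $V$ rejects $w$ with probability at least $1-\varepsilon$. The system is required to have bounded error in this sense, with $V$ halting with probability 1. *)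

(* Defs.v *)
From mathcomp Require Import all_boot all_order all_algebra.
From mathcomp Require Import all_classical all_reals all_analysis.
Set Implicit Arguments.
Unset Strict Implicit.
Unset Printing Implicit Defensive.
Import Order.TTheory GRing.Theory Num.Theory.
Import numFieldNormedType.Exports.
Local Open Scope ring_scope.

Inductive move := MoveL | Stay | MoveR.

(** * Recursive languages *)

(* Deterministic Turing machines with one two-way infinite tape. *)
Record TM (A : finType) := MkTM {
  tm_state : finType;
  tm_sym : finType;
  tm_blank : tm_sym;
  tm_inj : A -> tm_sym;
  tm_inj_inj : injective tm_inj;
  tm_inj_blank : forall a, tm_inj a != tm_blank;
  tm_start : tm_state;
  tm_acc : tm_state;
  tm_rej : tm_state;
  tm_acc_rej : tm_acc != tm_rej;
  tm_delta : tm_state -> tm_sym -> tm_state * tm_sym * move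
}.

Section TuringMachine.
Context {A : finType} (M : TM A).

(* [tm_left] is read from the head leftwards, [tm_right] starts with the scanned
   cell; all the cells beyond the two lists are blank. *)
Record tm_conf := TMConf {
  tm_cur : tm_state M;
  tm_left : seq (tm_sym M);
  tm_right : seq (tm_sym M)
}.

Definition tm_init (w : seq A) : tm_conf :=
  TMConf (tm_start M) [::] (map (@tm_inj A M) w).

Definition tm_step (c : tm_conf) : tm_conf :=
  let: TMConf q l r := c in
  if (q == tm_acc M) || (q == tm_rej M) then c else
  let: (q', s, d) := tm_delta q (head (tm_blank M) r) in
  let r' := behead r in
  match d with
  | MoveL => TMConf q' (behead l) [:: head (tm_blank M) l, s & r']
  | Stay => TMConf q' l (s :: r')
  | MoveR => TMConf q' (s :: l) r'
  end.

Definition tm_accepts (w : seq A) : Prop :=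
  exists n, tm_cur (iter n tm_step (tm_init w)) = tm_acc M.

Definition tm_rejects (w : seq A) : Prop :=
  exists n, tm_cur (iter n tm_step (tm_init w)) = tm_rej M.

End TuringMachine.

Definition recursive_language (A : finType) (L : seq A -> Prop) : Prop :=
  exists M : TM A, forall w,
    (L w -> tm_accepts M w) /\ (~ L w -> tm_rejects M w).

(** * Constant-space verifiers *)

(* The input is read between two end markers. *)
Inductive cell (A : Type) := LeftEnd | Letter of A | RightEnd.
Arguments LeftEnd {A}.
Arguments RightEnd {A}.

(* What the verifier does in one step; Q is its set of states, and Msg, S1, S0
   are the alphabets used by the verifier, by P1 and by P0. *)
Inductive instr (Q Msg S1 S0 : Type) :=
  | Move of move & Q
  | Toss of (bool -> Q)
  | Send of Msg & Q
  | Read1 of (S1 -> Q)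
  | Read0 of (S0 -> Q).

(* A two-way probabilistic finite automaton with fair private coins. *)
Record verifier (A : finType) := MkVerifier {
  v_state : finType;
  v_msg : finType;
  v_sym1 : finType;
  v_sym0 : finType;
  v_start : v_state;
  v_acc : v_state;
  v_rej : v_state;
  v_acc_rej : v_acc != v_rej;
  v_prog : v_state -> cell A -> instr v_state v_msg v_sym1 v_sym0
}.

Section Interaction.
Context {A : finType} (V : verifier A).

(* [event1]: what P1 is allowed to see; [event0]: what P0 is allowed to see,
   that is, the whole communication. *)
Inductive event1 := VMsg of v_msg V | P1Msg of v_sym1 V.
Inductive event0 := Public of event1 | P0Msg of v_sym0 V.

Definition view1 (log : seq event0) : seq event1 :=
  pmap (fun e => if e is Public e1 then Some e1 else None) log.

(* A deterministic prover is an arbitrary function of the input and of the part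
   of the communication that it sees, given with the latest event first. *)
Definition prover1 := seq A -> seq event1 -> v_sym1 V.
Definition prover0 := seq A -> seq event0 -> v_sym0 V.

Record v_conf := VConf {
  v_cur : v_state V;
  v_pos : nat;
  v_log : seq event0
}.

Definition v_init : v_conf := VConf (v_start V) 0 [::].

(* Positions 0 and (size w).+1 hold the end markers. *)
Definition scan (w : seq A) (i : nat) : cell A :=
  if i is j.+1 then
    if drop j w is a :: _ then Letter a else RightEnd
  else LeftEnd.

(* The head never leaves the marked input. *)
Definition move_head (w : seq A) (d : move) (i : nat) : nat :=
  match d with
  | MoveL => i.-1
  | Stay => i
  | MoveR => minn i.+1 (size w).+1
  end.

Definition v_halted (q : v_state V) : bool := (q == v_acc V) || (q == v_rej V).

(* One coin is supplied at every step; it is ignored except by [Toss]. *)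
Definition v_step (p1 : prover1) (p0 : prover0) (w : seq A)
    (c : v_conf) (coin : bool) : v_conf :=
  let: VConf q i log := c in
  if v_halted q then c else
  match v_prog q (scan w i) with
  | Move d q' => VConf q' (move_head w d i) log
  | Toss k => VConf (k coin) i log
  | Send m q' => VConf q' i (Public (VMsg m) :: log)
  | Read1 k => let s := p1 w (view1 log) in
               VConf (k s) i (Public (P1Msg s) :: log)
  | Read0 k => let s := p0 w log in
               VConf (k s) i (P0Msg s :: log)
  end.

Definition v_run (p1 : prover1) (p0 : prover0) (w : seq A)
    (coins : seq bool) : v_conf :=
  foldl (v_step p1 p0 w) v_init coins.

Section Probability.
Variable R : realType.

(* The probability that after t steps the current state satisfies P. *)
Definition prob_at (P : pred (v_state V)) (p1 : prover1) (p0 : prover0)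
    (w : seq A) (t : nat) : R :=
  #|[pred c : t.-tuple bool | P (v_cur (v_run p1 p0 w c))]|%:R / 2 ^+ t.

(* For a set P of halting states [prob_at] is nondecreasing in t, and the limit
   (which exists by [is_cvg_prob_at]) is the probability of ever reaching P. *)
Definition prob_halt_in (P : pred (v_state V)) (p1 : prover1) (p0 : prover0)
    (w : seq A) : R :=
  limn (prob_at P p1 p0 w).

Definition prob_accept := prob_halt_in (pred1 (v_acc V)).
Definition prob_reject := prob_halt_in (pred1 (v_rej V)).
Definition prob_halt := prob_halt_in v_halted.

Lemma prob_at_ub P p1 p0 w t : prob_at P p1 p0 w t <= 1.
Proof.
rewrite /prob_at ler_pdivrMr ?exprn_gt0 // mul1r -natrX ler_nat.
by rewrite (leq_trans (max_card _)) // card_tuple card_bool.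
Qed.

Lemma nondecreasing_prob_at (P : pred (v_state V)) p1 p0 w :
  {subset P <= v_halted} -> nondecreasing_seq (prob_at P p1 p0 w).
Proof.
move=> PH; apply/nondecreasing_seqP => t.
rewrite /prob_at exprS invfM mulrA ler_pM2r ?invr_gt0 ?exprn_gt0 //.
rewrite ler_pdivlMr // -natrM ler_nat.
pose S := [pred c : t.-tuple bool | P (v_cur (v_run p1 p0 w c))].
pose f (x : t.-tuple bool * bool) : t.+1.-tuple bool := [tuple of rcons x.1 x.2].
have f_inj : injective f.
  move=> [c b] [c' b'] /(congr1 val) /= /rcons_inj [cc' ->].
  by congr pair; apply: val_inj.
have -> : (#|S| * 2 = #|[predX S & predT : pred bool]|)%N.
  by rewrite cardX card_bool.
rewrite -/S -(fintype.card_image f_inj).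
apply/subset_leq_card/fintype.subsetP => _ /fintype.imageP [[c b] cS ->].
move: cS; rewrite !inE andbT /= /v_run foldl_rcons.
case: (foldl _ _ _) => q i log /= Pq.
have Hq : v_halted q := PH q Pq.
by rewrite Hq.
Qed.

Lemma is_cvg_prob_at (P : pred (v_state V)) p1 p0 w :
  {subset P <= v_halted} -> cvgn (prob_at P p1 p0 w).
Proof.
move=> PH; apply: nondecreasing_is_cvgn; first exact: nondecreasing_prob_at.
by exists 1 => _ [t _ <-]; exact: prob_at_ub.
Qed.

End Probability.

(* Halting with probability 1 is required, on every input, of the conversations
   in which at least one of the two provers is the one provided by the system:
   P1 against any opponent, or the P0 that answers a given P1.  If both provers
   are arbitrary they may jointly keep a finite-state verifier running. *)
Definition competing_prover_system (R : realType) (L : seq A -> Prop) (eps : R)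
    : Prop :=
  (exists p1 : prover1, forall p0 : prover0,
     (forall w, L w -> prob_accept R p1 p0 w >= 1 - eps) /\
     (forall w, prob_halt R p1 p0 w = 1)) /\
  (forall p1 : prover1, exists p0 : prover0,
     (forall w, ~ L w -> prob_reject R p1 p0 w >= 1 - eps) /\
     (forall w, prob_halt R p1 p0 w = 1)).

End Interaction.

(* Main.v *)
Require Import Defs.
From mathcomp Require Import all_boot all_order all_algebra.
From mathcomp Require Import all_classical all_reals all_analysis.
From HB Require Import structures.
From mathcomp Require Import zify ring lra.
Import Order.TTheory GRing.Theory Num.Theory.
Import numFieldNormedType.Exports.
Set Implicit Arguments.
Unset Strict Implicit.
Unset Printing Implicit Defensive.
Local Open Scope ring_scope.

(* The conversation is a sequence of rounds, each opened by a message of V. In a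
   round P1 writes the computation history of the Turing machine row by row. P0
   may mark a letter of some row, announcing that the letter of the next row that
   it determines is going to be wrong, and has to mark that letter too; V only
   remembers the letter it expects there. If the marked letter is wrong, V must
   find out whether the two marks are at the same offset. With a and b the number
   of letters up to the marks, V has been tossing coins so that an experiment
   drawn secretly at the start of the round survives with probability 4^-a, 4^-b
   (then V accepts) or 2^-(a+b) (then V rejects); otherwise a new round begins.
   For a = b the odds are 6 to 7, and for a <> b they are at least
   6 * (5/4) = 7.5 to 7, because 4^-a + 4^-b >= (5/2) 2^-(a+b).

   An honest P1 writes the true history, which determines a bounded length for
   every round. An honest P0 predicts the deterministic P1 and marks its first
   deviation from the true history, which occurs at a bounded place; so in both
   cases the probability that a round is decisive is bounded below. *)

(** * Rounds of a coin-driven process *)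

Section CoinAverage.
Context {C : Type} {R : realType} (step : C -> bool -> C).

(** Averaging an arbitrary observable, not only the indicator of an event, lets one identity
    quantified over [phi] carry the whole law of a configuration. *)
Fixpoint avg (t : nat) (phi : C -> R) (c : C) : R :=
  if t is u.+1 then (avg u phi (step c true) + avg u phi (step c false)) / 2
  else phi c.

Lemma avg0 phi c : avg 0 phi c = phi c.
Proof. by []. Qed.

Lemma avgS t phi c :
  avg t.+1 phi c = (avg t phi (step c true) + avg t phi (step c false)) / 2.
Proof. by []. Qed.

Lemma avg_add s t phi c : avg (s + t) phi c = avg s (avg t phi) c.
Proof. by elim: s c => [//|s IH] c; rewrite addSn /= !IH. Qed.

Lemma avg_fixed t phi c : (forall b, step c b = c) -> avg t phi c = phi c.
Proof. by move=> fix_c; elim: t => [//|t IH] /=; rewrite !fix_c IH mulrDl -splitr. Qed.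

Lemma card_tuple_cons t (Q : pred (seq bool)) :
  #|[pred x : t.+1.-tuple bool | Q x]| =
  (#|[pred x : t.-tuple bool | Q (true :: x)]| +
   #|[pred x : t.-tuple bool | Q (false :: x)]|)%N.
Proof.
rewrite -!sum1_card.
pose h (p : bool * t.-tuple bool) : t.+1.-tuple bool := [tuple of p.1 :: p.2].
have h_bij : bijective h.
  exists (fun x => (thead x, [tuple of behead x])).
    by case=> b x; rewrite /h /=; congr pair; apply: val_inj.
  by case/tupleP=> b x; apply: val_inj; rewrite /= theadE.
rewrite (reindex h); last exact: onW_bij.
rewrite (eq_bigl (fun p : bool * t.-tuple bool => predT p.1 && Q (p.1 :: p.2))); last by move=> p.
rewrite -(pair_big_dep predT (fun b (x : t.-tuple bool) => Q (b :: x))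
            (fun _ _ => 1%N)) /=.
by rewrite big_bool.
Qed.

Lemma card_avg (P : pred C) t c :
  #|[pred x : t.-tuple bool | P (foldl step c x)]|%:R / 2 ^+ t =
  avg t (fun c => (P c)%:R) c.
Proof.
elim: t c => [|t IH] c.
  rewrite expr0 divr1 /=; congr (_%:R).
  transitivity #|[pred x : 0.-tuple bool | P c]|.
    by apply: fintype.eq_card => x; rewrite [x]tuple0.
  case: (P c); last exact: fintype.card0.
  by rewrite -[RHS](card_tuple 0%N bool); apply: fintype.eq_card.
rewrite (@card_tuple_cons t (fun x => P (foldl step c x))) natrD exprS /= -!IH /=.
by rewrite invfM mulrA mulrAC -mulrDl.
Qed.

Context (halted target : pred C) (start : C -> Prop) (delta rho : R).
Hypothesis halted_fixed : forall c b, halted c -> step c b = c.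

(** In the debate below the coins never affect how long a round lasts, so one deterministic [T]
    suffices. *)
Definition round_ends (c : C) (p q : R) : Prop :=
  exists T win lose again,
    [/\ [/\ halted win, target win, halted lose & ~~ target lose], start again &
        forall phi, avg T phi c =
          p * phi win + q * phi lose + (1 - p - q) * phi again].

Definition fair_odds (p q : R) : Prop :=
  [/\ 0 <= p, 0 <= q, delta <= p + q, p + q <= 1 & rho * (p + q) <= p].

Hypothesis start_running : forall c, start c -> ~~ halted c.
Hypothesis fair_rounds :
  forall c, start c -> exists p q, fair_odds p q /\ round_ends c p q.

(** After [k] rounds the undecided mass is at most [(1 - delta) ^+ k]. The target has at least the
    share [rho] of what each round decides, hence of the total. The time depends on [c] because the
    length of a round does. *)
Lemma iterated_rounds k c : start c -> exists t,
  1 - (1 - delta) ^+ k <= avg t (fun c => (halted c)%:R) c /\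
  rho * avg t (fun c => (halted c)%:R) c <= avg t (fun c => (target c)%:R) c.
Proof.
elim: k c => [|k IH] c start_c.
  by exists 0%N; rewrite expr0 subrr /= (negbTE (start_running start_c)) mulr0.
have [p [q [[p0 q0 dpq pq1 rpq]]]] := fair_rounds start_c.
case=> T [win [lose [again [[hw tw hl tl] start_again avgE]]]].
have [t [ht tt]] := IH _ start_again.
have avg_win phi : avg t phi win = phi win.
  by apply: avg_fixed => b; exact: halted_fixed.
have avg_lose phi : avg t phi lose = phi lose.
  by apply: avg_fixed => b; exact: halted_fixed.
exists (T + t)%N; rewrite !avg_add !avgE !avg_win !avg_lose hw hl tw (negbTE tl).
have pow_ge0 : 0 <= (1 - delta) ^+ k by apply: exprn_ge0; lra.
move: ht tt; rewrite exprS.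
set H := avg t _ again; set G := avg t _ again; set z := (1 - delta) ^+ k.
rewrite -/z in pow_ge0.
move=> ht tt; rewrite !mulr1 mulr0 addr0; split.
  (* Here p + q + (1 - p - q)(1 - z) = 1 - (1 - p - q)z, and 1 - p - q <= 1 - delta. *)
  have : (1 - p - q) * (1 - z) <= (1 - p - q) * H by apply: ler_wpM2l => //; lra.
  have : (p + q - delta) * z >= 0 by apply: mulr_ge0 => //; lra.
  by move=> h1 h2; nra.
have : (1 - p - q) * (rho * H) <= (1 - p - q) * G by apply: ler_wpM2l => //; lra.
by move=> h1; nra.
Qed.

End CoinAverage.

Arguments avg : simpl never.

Lemma le_of_geometric (R : realType) (r x y : R) : 0 <= x < 1 ->
  (forall k, r * (1 - x ^+ k) <= y) -> r <= y.
Proof.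
case/andP=> x0 x1 le_y.
have cvg_x : (r * (1 - x ^+ k) @[k --> \oo] --> r)%classic.
  rewrite -[X in (_ --> X)%classic]mulr1; apply: cvgMr.
  rewrite -[X in (_ --> X)%classic]subr0; apply: cvgB; first exact: cvg_cst.
  by apply: cvg_expr; rewrite ger0_norm.
apply: (cvgr_to_le cvg_x).
by near=> k; exact: le_y.
Unshelve. all: by end_near. Qed.

(** * From rounds to limiting probabilities *)

Section Rounds.
Context {A : finType} {V : verifier A} {R : realType}.
Variables (p1 : prover1 V) (p0 : prover0 V) (w : seq A).

Lemma v_step_halted c b : v_halted (v_cur c) -> v_step p1 p0 w c b = c.
Proof. by case: c => q i log /= ->. Qed.

Lemma prob_at_avg (P : pred (v_state V)) t :
  prob_at R P p1 p0 w t =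
  avg (v_step p1 p0 w) t (fun c => (P (v_cur c))%:R) (v_init V).
Proof. by rewrite -(card_avg _ (fun c => P (v_cur c))). Qed.

Context (final : v_state V) (start : v_conf V -> Prop) (delta rho : R).

(** [prob_at] never exceeds its limit, so the bounds after [k] rounds pass to the limit; letting [k]
    grow removes the factor [1 - (1 - delta) ^+ k]. *)
Lemma prob_of_rounds :
  v_halted final -> 0 < delta <= 1 -> 0 <= rho -> start (v_init V) ->
  (forall c, start c -> ~~ v_halted (v_cur c)) ->
  (forall c, start c -> exists p q, fair_odds delta rho p q /\
     round_ends (v_step p1 p0 w) (fun c => v_halted (v_cur c))
       (fun c => v_cur c == final) start c p q) ->
  prob_halt R p1 p0 w = 1 /\ rho <= prob_halt_in R (pred1 final) p1 p0 w.
Proof.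
move=> final_halted /andP[d0 d1] rho0 start_init start_run rounds.
have iter_rounds k := iterated_rounds (fun c b => @v_step_halted c b) start_run
  rounds k start_init.
have halt_sub : {subset v_halted (V := V) <= v_halted (V := V)} by [].
have fin_sub : {subset pred1 final <= v_halted (V := V)}.
  by move=> q; rewrite inE => /eqP ->.
have le_lim P t : {subset P <= v_halted (V := V)} ->
    prob_at R P p1 p0 w t <= prob_halt_in R P p1 p0 w.
  move=> PH; apply: nondecreasing_cvgn_le; last exact: is_cvg_prob_at.
  exact: nondecreasing_prob_at.
split.
  apply/le_anti/andP; split.
    apply: limr_le; first exact: is_cvg_prob_at.
    by near=> t; exact: prob_at_ub.
  apply: (@le_of_geometric _ _ (1 - delta)); first by lra.
  move=> k; have [t [h _]] := iter_rounds k.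
  rewrite mul1r (le_trans h) //.
  have := le_lim _ t halt_sub; rewrite prob_at_avg; exact.
apply: (@le_of_geometric _ _ (1 - delta)); first by lra.
move=> k; have [t [h1 h2]] := iter_rounds k.
apply: le_trans (le_trans _ (le_lim _ t fin_sub)); first exact: ler_wpM2l h1.
by rewrite prob_at_avg.
Unshelve. all: by end_near. Qed.

End Rounds.

(** * The verifier *)

Section Protocol.
Context {A : finType} (M : TM A).

Definition tape_cell : finType := (tm_sym M * option (tm_state M))%type.
Definition letter : finType := option tape_cell.
Definition blank_cell : tape_cell := (tm_blank M, None).

Definition halting (q : tm_state M) : bool := (q == tm_acc M) || (q == tm_rej M).

(** Halting states are frozen in place, as in [tm_step], so the local rule also covers a finished
    computation. *)
Definition action (q : tm_state M) (s : tm_sym M) : tm_state M * tm_sym M * move :=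
  if halting q then (q, s, Stay) else tm_delta q s.

(* A row starts one cell further left than the row before it, so the letter at
   offset k depends on those at offsets k - 2, k - 1 and k above it. *)
Definition next_cell (x y z : tape_cell) : tape_cell :=
  match y.2 with
  | Some q => let: (q', s, d) := action q y.1 in
              (s, if d is Stay then Some q' else None)
  | None => (y.1,
      match x.2, z.2 with
      | Some q, _ => let: (q', _, d) := action q x.1 in
                     if d is MoveR then Some q' else None
      | None, Some q => let: (q', _, d) := action q z.1 in
                        if d is MoveL then Some q' else None
      | None, None => None
      end)
  end.

(* A row is a sequence of cells followed by three end marks [None]; in this way the
   end marks of a row, two letters longer, are determined by the row above. *)
Definition row_end (x y z : letter) : bool := [&& x == None, y == None & z == None].

Definition next_letter (x y z : letter) : letter :=
  if row_end x y z then None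
  else Some (next_cell (odflt blank_cell x) (odflt blank_cell y) (odflt blank_cell z)).

(* The last two letters of the row; [Some first] while V itself copies row 0 from
   the input; P0's pending claim, with the letter that P0's first mark announces
   and [true] once the row that must contain the second mark has begun. *)
Definition claim : finType := option (bool * letter).
Definition control : finType := (letter * letter * option bool * claim)%type.

Definition start_control : control :=
  (Some blank_cell, Some blank_cell, Some true, None).

Inductive decision := Verdict of bool | Test | Continue of control & bool.

(* V replaces what P1 says by the input in row 0, and by an end mark after one. *)
Definition true_letter (c : control) (a : cell A) (s : letter) : letter :=
  let: (_, y, copying, _) := c in
  if y is None then None else
  match copying, a with
  | None, _ => s
  | Some first, Letter a =>
      Some (tm_inj M a, if first then Some (tm_start M) else None)
  | Some first, _ => if first then Some (tm_blank M, Some (tm_start M)) else None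
  end.

(* The boolean of [Continue] tells V to forget the coins tossed in the row. *)
Definition proceed (c : control) (z : letter) (cl : claim) : decision :=
  let: (x, y, copying, _) := c in
  if row_end x y z then
    Continue (Some blank_cell, Some blank_cell, None,
              if cl is Some (_, e) then Some (true, e) else None) (cl == None)
  else Continue (y, z, if copying is Some _ then Some false else None, cl) false.

(** A mark takes precedence over a halting state, and no halting state is heeded while a claim is
    pending. P0 loses outright when the announced letter proves right or the second row ends
    unmarked; further marks in the first row are ignored. *)
Definition judge (c : control) (z : letter) (mark : bool) : decision :=
  let: (x, y, copying, cl) := c in
  match cl with
  | None =>
      if mark then proceed c z (Some (false, next_letter x y z)) else
      match z with
      | Some (_, Some q) =>
          if q == tm_acc M then Verdict true
          else if q == tm_rej M then Verdict false
          else proceed c z None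
      | _ => proceed c z None
      end
  | Some (false, _) => proceed c z cl
  | Some (true, e) =>
      if mark then (if z == e then Verdict true else Test)
      else if row_end x y z then Verdict true else proceed c z cl
  end.

(* [(true, b)] are the two experiments in favour of P1, [(false, true)] is the one
   in favour of P0, and [(false, false)] is inconclusive. *)
Definition experiment : finType := (bool * bool)%type.

(* The probabilities of the four experiments are 3/16, 3/16, 7/16 and 3/16. *)
Definition draw (a b c d : bool) : experiment :=
  if a then (if c && d then (false, false) else (true, b))
  else if b then (false, true)
  else if c && d then (false, false) else (false, true).

(** Heads required per counted letter: two in one of the rows give 4^-a or 4^-b, one in both rows
    gives 2^-(a+b), and the inconclusive experiment needs none. *)
Definition cost (t : experiment) (first_row : bool) : nat :=
  if t.1 then (if t.2 == first_row then 2 else 0)%N else t.2.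

Definition letter_cost (t : experiment) (cl : claim) : nat :=
  match cl with
  | None => cost t true
  | Some (false, _) => 0%N
  | Some (true, _) => cost t false
  end.

(* The experiment of the round, and whether all its coins have been heads so far. *)
Definition purse : finType := (experiment * bool)%type.

Inductive state :=
  | Accept | Reject | Rewind | Hello
  | Draw1 | Draw2 of bool | Draw3 of bool & bool | Draw4 of bool & bool & bool
  | Ask of control & purse
  | Flip1 of control * letter & purse
  | Flip2 of control * letter & purse
  | Advance of control * letter & purse
  | Point of control * letter & purse.

Definition state_code : Type :=
  ((bool * bool) + (unit + bool + bool * bool + bool * bool * bool)
   + control * purse + (bool * bool) * (control * letter * purse))%type.

Definition encode (q : state) : state_code :=
  match q with
  | Accept => inl (inl (inl (true, true)))
  | Reject => inl (inl (inl (true, false)))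
  | Rewind => inl (inl (inl (false, true)))
  | Hello => inl (inl (inl (false, false)))
  | Draw1 => inl (inl (inr (inl (inl (inl tt)))))
  | Draw2 a => inl (inl (inr (inl (inl (inr a)))))
  | Draw3 a b => inl (inl (inr (inl (inr (a, b)))))
  | Draw4 a b c => inl (inl (inr (inr (a, b, c))))
  | Ask c k => inl (inr (c, k))
  | Flip1 x k => inr ((true, true), (x, k))
  | Flip2 x k => inr ((true, false), (x, k))
  | Advance x k => inr ((false, true), (x, k))
  | Point x k => inr ((false, false), (x, k))
  end.

Definition decode (e : state_code) : state :=
  match e with
  | inl (inl (inl (true, true))) => Accept
  | inl (inl (inl (true, false))) => Reject
  | inl (inl (inl (false, true))) => Rewind
  | inl (inl (inl (false, false))) => Hello
  | inl (inl (inr (inl (inl (inl tt))))) => Draw1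
  | inl (inl (inr (inl (inl (inr a))))) => Draw2 a
  | inl (inl (inr (inl (inr (a, b))))) => Draw3 a b
  | inl (inl (inr (inr (a, b, c)))) => Draw4 a b c
  | inl (inr (c, k)) => Ask c k
  | inr ((true, true), (x, k)) => Flip1 x k
  | inr ((true, false), (x, k)) => Flip2 x k
  | inr ((false, true), (x, k)) => Advance x k
  | inr ((false, false), (x, k)) => Point x k
  end.

Lemma encodeK : cancel encode decode.
Proof. by case. Qed.

HB.instance Definition _ := Finite.copy state (can_type encodeK).

Definition test_outcome (k : purse) : state :=
  if k.2 && k.1.1 then Accept else if k.2 && k.1.2 then Reject else Rewind.

Definition after_mark (x : control * letter) (k : purse) (mark : bool) : state :=
  match judge x.1 x.2 mark with
  | Verdict v => if v then Accept else Reject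
  | Test => test_outcome k
  | Continue c reset => Ask c (k.1, reset || k.2)
  end.

(** Both tosses are made at every letter and those not due are ignored, which keeps all purses
    synchronised. They precede P0's mark, so the marked letters are themselves counted in a and
    b. *)
Definition flip (n : nat) (x : control * letter) (k : purse) (coin : bool) : purse :=
  (k.1, k.2 && ((letter_cost k.1 x.1.2 <= n)%N || coin)).

(** The head advances once per letter, so in row 0 it stands on the symbol to be copied; in later
    rows it rests on the right end marker. *)
Definition program (q : state) (a : cell A) : instr state unit letter bool :=
  match q with
  | Accept | Reject => Defs.Move _ _ _ Stay q
  | Rewind => if a is LeftEnd then Defs.Move _ _ _ MoveR Hello
              else Defs.Move _ _ _ MoveL Rewind
  | Hello => Send _ _ tt Draw1
  | Draw1 => Toss _ _ _ (fun b => Draw2 b)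
  | Draw2 a => Toss _ _ _ (fun b => Draw3 a b)
  | Draw3 a b => Toss _ _ _ (fun c => Draw4 a b c)
  | Draw4 a b c => Toss _ _ _ (fun d => Ask start_control (draw a b c d, true))
  | Ask c k => Read1 _ _ (fun s => Flip1 (c, true_letter c a s) k)
  | Flip1 x k => Toss _ _ _ (fun b => Flip2 x (flip 0 x k b))
  | Flip2 x k => Toss _ _ _ (fun b => Advance x (flip 1 x k b))
  | Advance x k => Defs.Move _ _ _ MoveR (Point x k)
  | Point x k => Read0 _ _ (fun m => after_mark x k m)
  end.

Lemma accept_reject : Accept != Reject.
Proof. by apply/eqP. Qed.

Definition debate : verifier A :=
  @MkVerifier A state unit letter bool Rewind Accept Reject accept_reject program.

Lemma haltedE (q : state) :
  v_halted (V := debate) q = match q with Accept | Reject => true | _ => false end.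
Proof.
rewrite /v_halted /=; case: q => *; rewrite ?eqxx ?orbT //;
  by apply/negbTE; rewrite negb_or; apply/andP; split; apply/eqP.
Qed.

End Protocol.

(** * The odds of one letter *)

Arguments v_step : simpl never.

Section RoundOdds.
Context {A : finType} (M : TM A) (R : realType).
Variables (p1 : prover1 (debate M)) (p0 : prover0 (debate M)) (w : seq A).

Local Notation vstep := (@v_step A (debate M) p1 p0 w).
Local Notation vconf := (@VConf A (debate M)).

Definition lerp (S x y : R) : R := S * x + (1 - S) * y.

Definition survival (t : experiment) (a b : nat) : R :=
  (1 / 2) ^+ (cost t true * a + cost t false * b)%N.

(* The coins influence only the [purse]; everything else in a round is determined
   by the provers, so one weight for each purse describes the distribution. *)
Definition mix (a b : nat) (g : experiment -> bool -> R) : R :=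
  let part t := lerp (survival t a b) (g t true) (g t false) in
  3 / 16 * part (true, true) + 3 / 16 * part (true, false)
  + 7 / 16 * part (false, true) + 3 / 16 * part (false, false).

Lemma stepE q i log b :
  vstep (vconf q i log) b =
  if match q with Accept | Reject => true | _ => false end then vconf q i log else
  match program q (scan w i) with
  | Defs.Move d q' => vconf q' (move_head w d i) log
  | Toss k => vconf (k b) i log
  | Send m q' => vconf q' i (Public (VMsg (V := debate M) m) :: log)
  | Read1 k => let s := p1 w (view1 log) in
               vconf (k s) i (Public (P1Msg (V := debate M) s) :: log)
  | Read0 k => let s := p0 w log in vconf (k s) i (P0Msg (V := debate M) s :: log)
  end.
Proof. by rewrite -haltedE. Qed.

Lemma avg_rewind (phi : v_conf (debate M) -> R) i log :
  avg vstep i.+1 phi (vconf (Rewind M) i log) =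
  phi (vconf (Hello M) 1 log).
Proof.
elim: i => [|i IH].
  by rewrite avgS !stepE /= minnSS min0n mulrDl -splitr.
have back b : vstep (vconf (Rewind M) i.+1 log) b = vconf (Rewind M) i log.
  by rewrite stepE /=; case: (drop i w).
by rewrite avgS !back IH mulrDl -splitr.
Qed.

Section Steps.
Variables (phi : v_conf (debate M) -> R) (t i : nat) (log : seq (event0 (debate M))).

Local Notation expect n q := (avg vstep n phi (vconf q i log)).

Lemma avg_hello : expect t.+1 (Hello M) =
  avg vstep t phi (vconf (Draw1 M) i (Public (VMsg (V := debate M) tt) :: log)).
Proof. by rewrite avgS !stepE mulrDl -splitr. Qed.

Lemma avg_draw1 :
  expect t.+1 (Draw1 M) = (expect t (Draw2 M true) + expect t (Draw2 M false)) / 2.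
Proof. by rewrite avgS !stepE. Qed.

Lemma avg_draw2 a :
  expect t.+1 (Draw2 M a) = (expect t (Draw3 M a true) + expect t (Draw3 M a false)) / 2.
Proof. by rewrite avgS !stepE. Qed.

Lemma avg_draw3 a b : expect t.+1 (Draw3 M a b) =
  (expect t (Draw4 M a b true) + expect t (Draw4 M a b false)) / 2.
Proof. by rewrite avgS !stepE. Qed.

Lemma avg_draw4 a b c : expect t.+1 (Draw4 M a b c) =
  (expect t (Ask (start_control M) (draw a b c true, true)) +
   expect t (Ask (start_control M) (draw a b c false, true))) / 2.
Proof. by rewrite avgS !stepE. Qed.

Lemma avg_ask c k : let s := p1 w (view1 log) in
  expect t.+1 (Ask c k) =
  avg vstep t phi (vconf (Flip1 (c, true_letter c (scan w i) s) k) i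
                     (Public (P1Msg s) :: log)).
Proof. by move=> s; rewrite avgS !stepE mulrDl -splitr. Qed.

Lemma avg_flip1 x k : expect t.+1 (Flip1 x k) =
  (expect t (Flip2 x (flip 0 x k true)) + expect t (Flip2 x (flip 0 x k false))) / 2.
Proof. by rewrite avgS !stepE. Qed.

Lemma avg_flip2 x k : expect t.+1 (Flip2 x k) =
  (expect t (Advance x (flip 1 x k true)) + expect t (Advance x (flip 1 x k false))) / 2.
Proof. by rewrite avgS !stepE. Qed.

Lemma avg_advance x k : expect t.+1 (Advance x k) =
  avg vstep t phi (vconf (Point x k) (minn i.+1 (size w).+1) log).
Proof. by rewrite avgS !stepE mulrDl -splitr. Qed.

Lemma avg_point x k : let m := p0 w log in
  expect t.+1 (Point x k) =
  avg vstep t phi (vconf (after_mark x k m) i (P0Msg m :: log)).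
Proof. by move=> m; rewrite avgS !stepE mulrDl -splitr. Qed.

End Steps.

(** The five steps after rewinding are the message and four coins, whose sixteen outcomes yield the
    weights of [mix]. No letter is counted yet, so every purse is alive. *)
Lemma avg_round_start (phi : v_conf (debate M) -> R) i log :
  avg vstep (i.+1 + 5) phi (vconf (Rewind M) i log) =
  mix 0 0 (fun t al =>
    phi (vconf (Ask (start_control M) (t, al)) 1 (Public (VMsg (V := debate M) tt) :: log))).
Proof.
rewrite avg_add avg_rewind.
rewrite avg_hello avg_draw1 !avg_draw2 !avg_draw3 !avg_draw4 !avg0.
rewrite /mix /survival /lerp !muln0 expr0 /=.
by field.
Qed.

(** Two fair coins, of which only the first [letter_cost] matter, amount to one coin that succeeds
    with probability 2^-cost. *)
Lemma avg_letter (phi : v_conf (debate M) -> R) c k i log :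
  let s := p1 w (view1 log) in
  let z := true_letter c (scan w i) s in
  let log1 := Public (P1Msg s) :: log in
  let m := p0 w log1 in
  avg vstep 5 phi (vconf (Ask c k) i log) =
  lerp ((1 / 2) ^+ letter_cost k.1 c.2)
    (phi (vconf (after_mark (c, z) k m) (minn i.+1 (size w).+1) (P0Msg m :: log1)))
    (phi (vconf (after_mark (c, z) (k.1, false) m) (minn i.+1 (size w).+1)
       (P0Msg m :: log1))).
Proof.
move=> s z log1 m.
rewrite avg_ask avg_flip1 !avg_flip2 !avg_advance !avg_point !avg0.
rewrite -/s -/log1 -/m -/z /flip /lerp /=.
case: k => t [] /=; last by rewrite -mulr2n; field.
have : (letter_cost t c.2 <= 2)%N.
  by rewrite /letter_cost /cost; case: c.2 => [[[] _]|]; case: t => [[] []].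
by case: (letter_cost _ _) => [|[|[|//]]] _ /=; field.
Qed.

Lemma eq_mix a b g h : (forall t al, g t al = h t al) -> mix a b g = mix a b h.
Proof. by move=> gh; rewrite /mix !gh. Qed.

Lemma mix_const a b g h : (forall t al, g t al = h t) ->
  mix a b g = mix 0 0 (fun t _ => h t).
Proof. by move=> gh; rewrite /mix /lerp !gh; ring. Qed.

Definition tally1 (cl : claim M) (a : nat) : nat := (a + (cl == None))%N.
Definition tally2 (cl : claim M) (b : nat) : nat :=
  (b + (if cl is Some (true, _) then 1 else 0))%N.

Lemma survival_letter t cl a b :
  survival t a b * (1 / 2) ^+ letter_cost t cl =
  survival t (tally1 cl a) (tally2 cl b).
Proof.
rewrite /survival -exprD; congr (_ ^+ _).
by rewrite /letter_cost /tally1 /tally2; case: cl => [[[] e]|] /=;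
  rewrite ?addn0 // mulnDr muln1; lia.
Qed.

(** Keeping [good] abstract lets one analysis serve both provers, the odds being read in favour of
    acceptance or of rejection. *)
Definition finishes (good : R -> R -> Prop) (c : control M) (a b i : nat)
    (log : seq (event0 (debate M))) : Prop :=
  exists (T : nat) (p q : R) (win lose again : v_conf (debate M)),
    [/\ good p q,
        [/\ v_cur win = Accept M :> state M, v_cur lose = Reject M :> state M
           & v_cur again = Rewind M :> state M] &
        forall phi : v_conf (debate M) -> R,
          mix a b (fun t al => avg vstep T phi (vconf (Ask c (t, al)) i log)) =
          p * phi win + q * phi lose + (1 - p - q) * phi again].

Section Letter.
Variables (c : control M) (i : nat) (log : seq (event0 (debate M))).
Let s := p1 w (view1 log).
Let z := true_letter c (scan w i) s.
Let log1 := Public (P1Msg s) :: log.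
Let m := p0 w log1.
Let i' := minn i.+1 (size w).+1.
Let log' := P0Msg m :: log1.

Lemma mix_letter (phi : v_conf (debate M) -> R) a b :
  mix a b (fun t al => avg vstep 5 phi (vconf (Ask c (t, al)) i log)) =
  mix (tally1 c.2 a) (tally2 c.2 b)
    (fun t al => phi (vconf (after_mark (c, z) (t, al) m) i' log')).
Proof.
rewrite (@eq_mix _ _ _ (fun t al => lerp ((1 / 2) ^+ letter_cost t c.2)
    (phi (vconf (after_mark (c, z) (t, al) m) i' log'))
    (phi (vconf (after_mark (c, z) (t, false) m) i' log')))); last first.
  by move=> t al; rewrite avg_letter.
by rewrite /mix -!survival_letter /lerp; ring.
Qed.

Lemma finishes_letter good a b :
  match judge c z m with
  | Verdict v => good v%:R (~~ v)%:R
  | Test => good (3 / 16 * ((1 / 4) ^+ tally1 c.2 a + (1 / 4) ^+ tally2 c.2 b))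
                 (7 / 16 * (1 / 2) ^+ (tally1 c.2 a + tally2 c.2 b))
  | Continue c' reset =>
      finishes good c' (if reset then 0%N else tally1 c.2 a)
        (if reset then 0%N else tally2 c.2 b) i' log'
  end -> finishes good c a b i log.
Proof.
case judged: (judge c z m) => [v||c' reset].
- move=> good_v.
  exists 5%N, v%:R, (~~ v)%:R, (vconf (Accept M) i' log'), (vconf (Reject M) i' log'),
    (vconf (Rewind M) i' log'); split=> // phi.
  rewrite mix_letter /after_mark judged /mix /lerp.
  by case: v {judged good_v} => /=; field.
- move=> good_t.
  exists 5%N; do 2 eexists; exists (vconf (Accept M) i' log'), (vconf (Reject M) i' log'),
    (vconf (Rewind M) i' log'); split; [exact: good_t | by [] |] => phi.
  rewrite mix_letter /after_mark judged /mix /lerp /survival /test_outcome /cost /=.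
  rewrite !mul0n !addn0 !add0n !mul1n expr0 !exprM.
  have -> : (1 / 2) ^+ 2 = 1 / 4 :> R by rewrite expr2; field.
  by field.
case=> T [p [q [win [lose [again [good_pq curs avgE]]]]]].
exists (5 + T)%N, p, q, win, lose, again; split=> // phi.
rewrite (@eq_mix _ _ _ (fun t al => avg vstep 5 (avg vstep T phi)
    (vconf (Ask c (t, al)) i log))); last by move=> t al; rewrite avg_add.
rewrite mix_letter -avgE /after_mark judged /=.
case: reset {judged avgE} => /=; last by [].
(* A reset revives every purse, so the surviving fraction no longer matters and both tallies restart
   at zero. *)
rewrite (@mix_const _ _ _ (fun t => avg vstep T phi (vconf (Ask c' (t, true)) i' log'))) //.
by rewrite /mix /lerp /survival !muln0 expr0; ring.
Qed.

End Letter.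

End RoundOdds.

(** * The rows of a computation history *)

Section History.
Context {A : finType} (M : TM A).

(** The displacement of the head plus one, since the next row has one more cell on the left. *)
Definition shift (d : move) : nat :=
  match d with MoveL => 0 | Stay => 1 | MoveR => 2 end.

Definition tape (c : tm_conf M) (h k : nat) : tape_cell M :=
  if k == h then (head (tm_blank M) (tm_right c), Some (tm_cur c))
  else if (k < h)%N then (nth (tm_blank M) (tm_left c) (h - k).-1, None)
  else (nth (tm_blank M) (tm_right c) (k - h), None).

Lemma tape_head c h k : k = h ->
  tape c h k = (head (tm_blank M) (tm_right c), Some (tm_cur c)).
Proof. by move=> ->; rewrite /tape eqxx. Qed.

Lemma tape_left c h k n : h = (k + n).+1 ->
  tape c h k = (nth (tm_blank M) (tm_left c) n, None).
Proof.
move=> ->; rewrite /tape ltnS leq_addr ifN ?subSn ?leq_addr //=; last by lia.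
by rewrite addKn.
Qed.

Lemma tape_right c h k n : k = (h + n).+1 ->
  tape c h k = (nth (tm_blank M) (tm_right c) n.+1, None).
Proof.
move=> ->; rewrite /tape !ifN; [|lia..].
by rewrite subSn ?leq_addr // addKn.
Qed.

Lemma tape_add c h k j : tape c (h + j) (k + j) = tape c h k.
Proof. by rewrite /tape eqn_add2r ltn_add2r !subnDr. Qed.

Definition scanned_action (c : tm_conf M) :=
  action (tm_cur c) (head (tm_blank M) (tm_right c)).

(** Moving the head to [h.+2] expresses the offsets [k - 2], [k - 1] and [k] of the upper row
    without subtraction. The cases are the three offsets where the new head may land and the two
    sides beyond them. *)
Lemma tape_step c h k :
  tape (tm_step c) (h + shift (scanned_action c).2) k =
  next_cell (tape c h.+2 k) (tape c h.+2 k.+1) (tape c h.+2 k.+2).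
Proof.
case: c => q l r; rewrite /scanned_action /tm_step /=.
have actE s : action q s = if (q == tm_acc M) || (q == tm_rej M)
  then (q, s, Stay) else tm_delta q s by [].
have [->|[->|[->|[lt_kh|lt_hk]]]] :
    k = h \/ k = h.+1 \/ k = h.+2 \/ (k < h)%N \/ (h.+2 < k)%N by lia.
- rewrite (@tape_left (TMConf q l r) h.+2 h 1)
    1?(@tape_left (TMConf q l r) h.+2 h.+1 0)
    1?(@tape_head (TMConf q l r) h.+2 h.+2); [|lia..].
  rewrite /next_cell /= actE.
  case: ifP => _ /=; first by rewrite (@tape_left _ _ _ 0) //; lia.
  case: (tm_delta _ _) => [[q' s] []] /=.
  + by rewrite tape_head /= ?nth0 //; lia.
  + by rewrite (@tape_left _ _ _ 0) //; lia.
  + by rewrite (@tape_left _ _ _ 1) //; lia.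
- rewrite (@tape_left (TMConf q l r) h.+2 h.+1 0)
    1?(@tape_right (TMConf q l r) h.+2 h.+3 0)
    1?(@tape_head (TMConf q l r) h.+2 h.+2); [|lia..].
  rewrite /next_cell /= actE.
  case: ifP => _ /=; first by rewrite tape_head //; lia.
  case: (tm_delta _ _) => [[q' s] []] /=.
  + by rewrite (@tape_right _ _ _ 0) //; lia.
  + by rewrite tape_head //; lia.
  + by rewrite (@tape_left _ _ _ 0) //; lia.
- rewrite (@tape_right (TMConf q l r) h.+2 h.+3 0)
    1?(@tape_right (TMConf q l r) h.+2 h.+4 1)
    1?(@tape_head (TMConf q l r) h.+2 h.+2); [|lia..].
  rewrite /next_cell /= actE.
  case: ifP => _ /=; first by rewrite (@tape_right _ _ _ 0) //; lia.
  case: (tm_delta _ _) => [[q' s] []] /=.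
  + by rewrite (@tape_right _ _ _ 1) /= ?nth_behead //; lia.
  + by rewrite (@tape_right _ _ _ 0) /= ?nth_behead //; lia.
  + by rewrite tape_head /= -?nth0 ?nth_behead //; lia.
- have -> : h = (k + (h - k.+1)).+1 by lia.
  move: (h - k.+1)%N => n {lt_kh h}.
  rewrite (@tape_left (TMConf q l r) _ k n.+2)
    1?(@tape_left (TMConf q l r) _ k.+1 n.+1)
    1?(@tape_left (TMConf q l r) _ k.+2 n); [|lia..].
  rewrite /next_cell /= actE.
  case: ifP => _ /=; first by rewrite (@tape_left _ _ _ n.+1) //; lia.
  case: (tm_delta _ _) => [[q' s] []] /=.
  + by rewrite (@tape_left _ _ _ n) /= ?nth_behead //; lia.
  + by rewrite (@tape_left _ _ _ n.+1) //; lia.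
  + by rewrite (@tape_left _ _ _ n.+2) //; lia.
have -> : k = (h + (k - h.+3)).+3 by lia.
move: (k - h.+3)%N => n {lt_hk k}.
rewrite (@tape_right (TMConf q l r) h.+2 (h + n).+3 n)
    1?(@tape_right (TMConf q l r) h.+2 (h + n).+4 n.+1)
  1?(@tape_right (TMConf q l r) h.+2 (h + n).+4.+1 n.+2); [|lia..].
rewrite /next_cell /= actE.
case: ifP => _ /=; first by rewrite (@tape_right _ _ _ n.+1) //; lia.
case: (tm_delta _ _) => [[q' s] []] /=.
+ by rewrite (@tape_right _ _ _ n.+2) /= ?nth_behead //; lia.
+ by rewrite (@tape_right _ _ _ n.+1) /= ?nth_behead //; lia.
+ by rewrite (@tape_right _ _ _ n) /= ?nth_behead //; lia.
Qed.

Section Run.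
Variable w : seq A.

Definition config (i : nat) : tm_conf M := iter i (@tm_step A M) (tm_init M w).

Fixpoint head_at (i : nat) : nat :=
  if i is j.+1 then (head_at j + shift (scanned_action (config j)).2)%N else 0%N.

(** The [.-1.+1] keeps one cell for the head on the empty input; each step adds a cell at either
    end. *)
Definition width (i : nat) : nat := ((size w).-1.+1 + i.*2)%N.

Definition history (i k : nat) : letter M :=
  if (k < width i)%N then Some (tape (config i) (head_at i) k) else None.

Definition history_back (i k j : nat) : letter M :=
  if (k < j)%N then Some (blank_cell M) else history i (k - j).

Lemma widthS i : width i.+1 = (width i).+2.
Proof. by rewrite /width doubleS !addnS. Qed.

(** The written part of the tape lies inside the row, so the virtual letters before a row and the
    end marks after it may be read as blanks. *)
Lemma config_fits i :
  [/\ (size (tm_left (config i)) <= head_at i)%N, (head_at i < width i)%N &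
      (size (tm_right (config i)) <= width i - head_at i)%N].
Proof.
elim: i => [|i].
  by rewrite /config /= /width size_map; split=> //; lia.
rewrite widthS /= /scanned_action.
case: (config i) => q l r /=; move: (head_at i) (width i) => h W [hl hW hr].
rewrite /action /halting; case: ifP => _ /=; first by split; lia.
by case: (tm_delta _ _) => [[q' s] []] /=; rewrite ?size_behead; split; lia.
Qed.

Lemma history_backE i k j :
  odflt (blank_cell M) (history_back i k j) =
  tape (config i) (head_at i + j) k.
Proof.
have [fl fh fr] := config_fits i.
rewrite /history_back; case: ltnP => [lt_kj|le_jk] /=.
  rewrite (@tape_left _ _ _ (head_at i + j - k.+1)); last by lia.
  by rewrite nth_default //; lia.
rewrite -[in RHS](subnK le_jk) tape_add /history.
case: ltnP => //= le_Wk.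
rewrite (@tape_right _ _ _ (k - j - (head_at i).+1)); last by lia.
by rewrite nth_default //; lia.
Qed.

Lemma history_row_end i k :
  row_end (history_back i k 2) (history_back i k 1) (history_back i k 0) =
  ((width i).+2 <= k)%N.
Proof.
rewrite /row_end /history_back /history subn0 ltn0.
have [lt_k2|le_2k] := ltnP k 2; first by apply/esym/negbTE; rewrite -ltnNge; lia.
have -> : (k < 1)%N = false by lia.
have [lt_kW|le_Wk] := ltnP (k - 2) (width i).
  by apply/esym/negbTE; rewrite -ltnNge; lia.
have -> : (k - 1 < width i)%N = false by lia.
have -> : (k < width i)%N = false by lia.
by rewrite !eqxx /=; apply/esym/idP; lia.
Qed.

Lemma history_next i k :
  history i.+1 k =
  next_letter (history_back i k 2) (history_back i k 1) (history_back i k 0).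
Proof.
rewrite /next_letter history_row_end {1}/history widthS ltnNge if_neg.
case: ifP => // _; congr Some.
rewrite /= tape_step !history_backE.
by rewrite addn2 -[RHS]/(next_cell _ _ _) -(tape_add _ (head_at i + 1) k 1)
  -(tape_add _ (head_at i + 0) k 2) !addn1 !addn2 addn0.
Qed.

End Run.
End History.

(** * Places in the history *)

Section Places.
Context {A : finType} (w : seq A).

(** Row and offset of letter [m] of a round whose rows have their true lengths, that is [width + 3]
    with the end marks. *)
Fixpoint place (m : nat) : nat * nat :=
  if m is n.+1 then
    let: (i, k) := place n in
    if (k < (width w i).+2)%N then (i, k.+1) else (i.+1, 0%N)
  else (0%N, 0%N).

Lemma placeS n : place n.+1 =
  if ((place n).2 < (width w (place n).1).+2)%N then ((place n).1, (place n).2.+1)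
  else ((place n).1.+1, 0%N).
Proof. by rewrite /=; case: (place n). Qed.

Lemma place_bound m i k : place m = (i, k) -> (k <= (width w i).+2)%N.
Proof.
elim: m i k => [|m IH] i k /=; first by case=> <- <-.
case: (place m) IH => i' k' /(_ _ _ erefl) _; case: ifP => [lt_k|_] [<- <-] //.
Qed.

Lemma place_add m i k j : place m = (i, k) -> (k + j <= (width w i).+2)%N ->
  place (m + j) = (i, (k + j)%N).
Proof.
move=> place_m; elim: j => [|j IH] le_j; first by rewrite !addn0.
rewrite addnS /= IH; last by lia.
by rewrite ifT ?addnS //; lia.
Qed.

Lemma place_next_row m i k : place m = (i, k) ->
  place (m + (width w i).+3) = (i.+1, k).
Proof.
move=> place_m; have le_k := place_bound place_m.
have at_end : place (m + ((width w i).+2 - k)) = (i, (width w i).+2).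
  by rewrite (place_add place_m) subnKC.
have row_start : place (m + ((width w i).+2 - k)).+1 = (i.+1, 0%N).
  by rewrite /= at_end ltnn.
rewrite -(place_add (j := k) row_start); last by rewrite widthS; lia.
by congr place; lia.
Qed.

Lemma place_row0 m k : place m = (0%N, k) -> m = k.
Proof.
elim: m k => [|m IH] k /=; first by case.
case: (place m) IH => i' k' IH; case: ifP => // _ [i0 <-].
by congr S; apply: IH; rewrite i0.
Qed.

Lemma place_lt m m' i k i' k' : place m = (i, k) -> place m' = (i', k') ->
  (m < m')%N -> (i < i')%N \/ i = i' /\ (k < k')%N.
Proof.
move=> place_m place_m' lt_m.
have [j def_m'] : exists j, m' = (m + j).+1 by exists (m' - m.+1)%N; lia.
move: place_m'; rewrite {}def_m' {lt_m m'}.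
elim: j i' k' => [|j IH] i' k'.
  by rewrite addn0 /= place_m; case: ifP => _ [<- <-]; lia.
rewrite addnS placeS; case: (place _) IH => i1 k1 /(_ _ _ erefl) /= IH.
by case: ifP => _ [<- <-]; lia.
Qed.

Lemma place_inj : injective place.
Proof.
move=> m m' eq_place; case def: (place m) => [i k].
have def' : place m' = (i, k) by rewrite -eq_place.
case: (ltngtP m m') => // lt_m.
  by have := place_lt def def' lt_m; lia.
by have := place_lt def' def lt_m; lia.
Qed.

Lemma place_onto i k : (k <= (width w i).+2)%N -> exists m, place m = (i, k).
Proof.
move=> le_k; suff [m place_m] : exists m, place m = (i, 0%N).
  by exists (m + k)%N; rewrite (place_add place_m).
elim: {k le_k} i => [|i [m place_m]]; first by exists 0%N.
by exists (m + (width w i).+3)%N; exact: place_next_row.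
Qed.

End Places.

(** * The verifier's reaction to true letters *)

Section Faithful.
Context {A : finType} (M : TM A) (w : seq A).

Definition control_at (i k : nat) (cl : claim M) : control M :=
  (history_back M w i k 2, history_back M w i k 1,
   if i is 0 then Some (k == 0)%N else None, cl).

Lemma start_controlE : start_control M = control_at 0 0 None.
Proof. by []. Qed.

Lemma history_back1_some i k :
  isSome (history_back M w i k 1) = (k <= width w i)%N.
Proof.
rewrite /history_back /history; case: k => [|k] //=.
by rewrite subn1 /=; case: ltnP => /=; lia.
Qed.

Lemma row0_letter k s :
  true_letter (control_at 0 k None) (scan w (minn k.+1 (size w).+1)) s =
  history M w 0 k.
Proof.
rewrite /true_letter /control_at.
have := history_back1_some 0 k; case: (history_back _ _ _ _ _) => [x|] /=; last first.
  by move=> /esym le_k; rewrite /history ifN //; lia.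
move=> /esym; rewrite /width addn0 => le_k.
rewrite /history /width addn0 minnSS.
have [lt_kn|le_nk] := ltnP k (size w).
  have -> /= : (k < (size w).-1.+1)%N by lia.
  case def_d: (drop k w) => [|a t].
    by have := size_drop k w; rewrite def_d /=; lia.
  have nth_a : nth (tm_blank M) (map (@tm_inj A M) w) k = tm_inj M a.
    by rewrite -[k]addn0 -nth_drop -map_drop def_d.
  case: k {lt_kn le_k def_d} nth_a => [|k] nth_a.
    by rewrite tape_head //= -nth0 nth_a.
  by rewrite (@tape_right _ _ _ _ _ k) //= nth_a.
rewrite /= drop_size.
(* Beyond the input, offset 0 occurs only for the empty input, whose single cell carries the start
   state; any other offset holds an end mark. *)
case: k le_k le_nk => [|k] le_k le_nk /=; last by rewrite ifN //; lia.
have /size0nil -> : size w = 0%N by lia.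
by rewrite tape_head.
Qed.

(** V copies row 0 and completes the end marks itself, so P1's word matters only in later rows, up
    to the first end mark. *)
Lemma faithful_letter m i k cl s : place w m = (i, k) ->
  ((0 < i)%N -> (k <= width w i)%N -> s = history M w i k) ->
  true_letter (control_at i k cl) (scan w (minn m.+1 (size w).+1)) s =
  history M w i k.
Proof.
case: i => [|i] place_m honest.
  by rewrite (place_row0 place_m) -(row0_letter k s).
rewrite /true_letter /control_at.
have := history_back1_some i.+1 k; case: (history_back _ _ _ _ _) => [x|] /=; last first.
  by move=> /esym le_k; rewrite /history ifN //; lia.
by move=> /esym /honest ->.
Qed.

Lemma judge_second_row i k e z mark :
  judge (control_at i k (Some (true, e))) z mark =
  if mark then (if z == e then Verdict M true else Test M)
  else if row_end (history_back M w i k 2) (history_back M w i k 1) z then Verdict M true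
  else proceed (control_at i k (Some (true, e))) z (Some (true, e)).
Proof. by []. Qed.

Lemma judge_first_row i k e z mark :
  judge (control_at i k (Some (false, e))) z mark =
  proceed (control_at i k (Some (false, e))) z (Some (false, e)).
Proof. by []. Qed.

Lemma judge_first_mark i k :
  judge (control_at i k None) (history M w i k) true =
  proceed (control_at i k None) (history M w i k) (Some (false, history M w i.+1 k)).
Proof. by rewrite history_next [history_back M w i k 0]/history_back subn0. Qed.

Definition promote (cl : claim M) : claim M :=
  if cl is Some (_, e) then Some (true, e) else None.

Lemma faithful_row_end i k : (k <= (width w i).+2)%N ->
  row_end (history_back M w i k 2) (history_back M w i k 1) (history M w i k) =
  ~~ (k < (width w i).+2)%N.
Proof.
move=> le_k; have := history_row_end M w i k.
by rewrite [history_back M w i k 0]/history_back subn0 ltn0 -leqNgt => ->.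
Qed.

Lemma proceed_faithful i k cl cl' : (k <= (width w i).+2)%N ->
  proceed (control_at i k cl') (history M w i k) cl =
  if (k < (width w i).+2)%N then Continue (control_at i k.+1 cl) false
  else Continue (control_at i.+1 0 (promote cl)) (cl == None).
Proof.
move=> le_k; rewrite /proceed /control_at faithful_row_end //.
case: ltnP => _ //=; congr (Continue (_, _, _, _) _).
- by rewrite /history_back subSS subn0.
- by case: i {le_k}.
Qed.

End Faithful.

Arguments judge : simpl never.
Arguments proceed : simpl never.

(** * The course of a round *)

Section Play.
Context {A : finType} (M : TM A) (R : realType).
Variables (p1 : prover1 (debate M)) (p0 : prover0 (debate M)) (w : seq A).
Variable log0 : seq (event0 (debate M)).

Fixpoint round_log (m : nat) : seq (event0 (debate M)) :=
  if m is n.+1 then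
    let log := Public (P1Msg (p1 w (view1 (round_log n)))) :: round_log n in
    P0Msg (p0 w log) :: log
  else log0.

Definition said (m : nat) : letter M := p1 w (view1 (round_log m)).

Definition marked (m : nat) : bool :=
  p0 w (Public (P1Msg (V := debate M) (said m)) :: round_log m).

Variable good : R -> R -> Prop.

Definition plays (m : nat) (c : control M) (a b : nat) : Prop :=
  finishes p1 p0 w good c a b (minn m.+1 (size w).+1) (round_log m).

Definition test_good (a b : nat) : Prop :=
  good (3 / 16 * ((1 / 4) ^+ a + (1 / 4) ^+ b)) (7 / 16 * (1 / 2) ^+ (a + b)).

Lemma plays_letter m c a b :
  match judge c (true_letter c (scan w (minn m.+1 (size w).+1)) (said m)) (marked m) with
  | Verdict v => good v%:R (~~ v)%:R
  | Test => test_good (tally1 c.2 a) (tally2 c.2 b)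
  | Continue c' reset =>
      plays m.+1 c' (if reset then 0%N else tally1 c.2 a)
        (if reset then 0%N else tally2 c.2 b)
  end -> plays m c a b.
Proof.
rewrite /plays; have -> : minn m.+2 (size w).+1 =
    minn (minn m.+1 (size w).+1).+1 (size w).+1 by lia.
exact: finishes_letter.
Qed.

(** [T] is the first halting time and [K] the letter that shows the halting state, where a true and
    unmarked round is decided. *)
Definition halting_place (T K : nat) : Prop :=
  [/\ halting (tm_cur (config M w T)),
      forall j, (j < T)%N -> ~~ halting (tm_cur (config M w j)) &
      place w K = (T, head_at M w T)].

Variables T K : nat.
Hypothesis halts_at : halting_place T K.

Lemma width_le i j : (i <= j)%N -> (width w i <= width w j)%N.
Proof. by rewrite /width; lia. Qed.

Lemma place_le m i k : place w m = (i, k) -> (m <= K)%N -> (i <= T)%N.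
Proof.
case: halts_at => _ _ place_K place_m; rewrite leq_eqVlt => /orP[/eqP eq_m|lt_m].
  by move: place_m; rewrite eq_m place_K; case; lia.
by have := place_lt place_m place_K lt_m; lia.
Qed.

Lemma judge_running m i k : place w m = (i, k) -> (m < K)%N ->
  judge (control_at w i k None) (history M w i k) false =
  proceed (control_at w i k None) (history M w i k) None.
Proof.
case: halts_at => _ running place_K place_m lt_m.
have := place_lt place_m place_K lt_m => before.
rewrite /judge /control_at /history; case: ifP => // _; rewrite /tape.
case: eqP => [eq_k|_]; last by case: ifP.
have : ~~ halting (tm_cur (config M w i)) by apply: running;
  case: before => // -[eq_i]; rewrite eq_k eq_i ltnn.
by rewrite /halting negb_or => /andP[/negbTE -> /negbTE ->].
Qed.

Lemma judge_halting :
  judge (control_at w T (head_at M w T) None) (history M w T (head_at M w T)) false =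
  Verdict M (tm_cur (config M w T) == tm_acc M).
Proof.
case: halts_at => halted _ _; have [_ fits _] := config_fits M w T.
rewrite /judge /control_at /history fits tape_head //.
by move: halted; rewrite /halting; case: eqP => //= _ ->.
Qed.

(** * Rounds in which P1 writes the true history *)

Section HonestP1.
Hypothesis honest : forall m, said m = history M w (place w m).1 (place w m).2.
Hypothesis good_accept : good 1 0.
Hypothesis good_verdict :
  good (tm_cur (config M w T) == tm_acc M)%:R (tm_cur (config M w T) != tm_acc M)%:R.
Hypothesis good_test : forall a b, a <> b -> (a + b <= (width w T + 4).*2)%N ->
  test_good a b.

Let honest_letter m i k cl : place w m = (i, k) ->
  true_letter (control_at w i k cl) (scan w (minn m.+1 (size w).+1)) (said m) =
  history M w i k.
Proof. by move=> place_m; apply: faithful_letter => // _ _; rewrite honest place_m. Qed.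

Let row_step m i k : place w m = (i, k) ->
  place w m.+1 = if (k < (width w i).+2)%N then (i, k.+1) else (i.+1, 0%N).
Proof. by move=> place_m; rewrite placeS place_m. Qed.

(** All letters are true, so a second mark on a letter other than the announced one stands at
    another offset, and the test runs with unequal tallies. *)
Lemma second_row j m i k k1 : (i <= T)%N -> (k1 <= (width w i).+2)%N ->
  place w m = (i.+1, k) -> (k + j)%N = (width w i.+1).+2 ->
  plays m (control_at w i.+1 k (Some (true, history M w i.+1 k1))) k1.+1 k.
Proof.
move=> le_i le_k1; elim: j m k => [|j IH] m k place_m def_j; apply: plays_letter;
  rewrite (honest_letter _ place_m) judge_second_row /tally1 /tally2 /= addn0 addn1.
  all: have le_k := place_bound place_m; have le_W := width_le le_i; have W1 := widthS w i.
  (* The tallies are at most [width w T + 3] and [width w T + 5], whence the bound on their sum. *)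
  all: case: (marked m); first by case: eqP => // neq; apply: good_test; [congruence|lia].
  all: rewrite faithful_row_end //.
    by rewrite ifT // -leqNgt; lia.
rewrite ifN; last by rewrite negbK; lia.
rewrite proceed_faithful  // ifT; last by lia.
by apply: IH; rewrite ?(row_step place_m) ?ifT  //; lia.
Qed.

Lemma first_row_rest j m i k k1 : (i <= T)%N -> (k1 <= (width w i).+2)%N ->
  place w m = (i, k) -> (k + j)%N = (width w i).+2 ->
  plays m (control_at w i k (Some (false, history M w i.+1 k1))) k1.+1 0.
Proof.
move=> le_i le_k1; elim: j m k => [|j IH] m k place_m def_j; apply: plays_letter;
  rewrite (honest_letter _ place_m) judge_first_row /tally1 /tally2 /= addn0;
  rewrite proceed_faithful ?(place_bound place_m) //.
  rewrite ifN /=; last by lia.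
  apply: (@second_row (width w i.+1).+2) => //.
  by rewrite (row_step place_m) ifN //; lia.
rewrite ifT /=; last by lia.
by apply: IH; rewrite ?(row_step place_m) ?ifT //; lia.
Qed.

Lemma honest_play j m i k : (m + j)%N = K -> place w m = (i, k) ->
  plays m (control_at w i k None) k 0.
Proof.
elim: j m i k => [|j IH] m i k def_j place_m; apply: plays_letter;
  rewrite (honest_letter _ place_m) /tally1 /tally2 /= addn0 addn1.
  all: have le_k := place_bound place_m; have le_i := place_le place_m ltac:(lia).
  all: case mark: (marked m); first rewrite judge_first_mark.
  all: try (rewrite proceed_faithful //; case: ifP => lt_k /=;
    [apply: (@first_row_rest ((width w i).+1 - k))|apply: (@second_row (width w i.+1).+2)];
    rewrite ?(row_step place_m) ?lt_k //; lia).
  have eq_m : m = K by lia.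
  move: place_m; rewrite eq_m; case: halts_at => _ _ -> [<- <-].
  by rewrite judge_halting.
rewrite (judge_running place_m); last by lia.
rewrite proceed_faithful //; case: ifP => lt_k /=; apply: IH;
  rewrite ?(row_step place_m) ?lt_k //; lia.
Qed.

End HonestP1.

(** * Rounds in which P0 stays silent or points at the first lie *)

Section PointingP0.
Hypothesis good_verdict :
  good (tm_cur (config M w T) == tm_acc M)%:R (tm_cur (config M w T) != tm_acc M)%:R.
Hypothesis good_test : forall a, (a + a <= (width w T + 4).*2)%N -> test_good a a.

Definition deviates (s : nat -> letter M) (m : nat) : bool :=
  let: (i, k) := place w m in
  [&& (0 < i)%N, (k <= width w i)%N & s m != history M w i k].

Let row_step m i k : place w m = (i, k) ->
  place w m.+1 = if (k < (width w i).+2)%N then (i, k.+1) else (i.+1, 0%N).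
Proof. by move=> place_m; rewrite placeS place_m. Qed.

Let true_said m i k cl : place w m = (i, k) -> ~~ deviates said m ->
  true_letter (control_at w i k cl) (scan w (minn m.+1 (size w).+1)) (said m) =
  history M w i k.
Proof.
move=> place_m; rewrite /deviates place_m => faithful; apply: faithful_letter => //.
by move=> i0 le_k; move: faithful; rewrite i0 le_k /= negbK => /eqP.
Qed.

Lemma faithful_play j m i k : (m + j)%N = K -> place w m = (i, k) ->
  (forall n, (n <= K)%N -> ~~ deviates said n /\ ~~ marked n) ->
  plays m (control_at w i k None) k 0.
Proof.
move=> def_j place_m faithful.
elim: j m i k def_j place_m => [|j IH] m i k def_j place_m; apply: plays_letter;
  have [//|fm mm] := faithful m; try lia;
  rewrite (true_said _ place_m fm) (negbTE mm) /tally1 /tally2 /= addn0 addn1.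
  have eq_m : m = K by lia.
  move: place_m; rewrite eq_m; case: halts_at => _ _ -> [<- <-].
  by rewrite judge_halting.
have le_k := place_bound place_m.
rewrite (judge_running place_m); last by lia.
rewrite proceed_faithful //; case: ifP => lt_k /=; apply: IH;
  rewrite ?(row_step place_m) ?lt_k //; lia.
Qed.

Section Lie.
Variables (m1 m2 i1 k1 : nat).
Hypothesis place_m1 : place w m1 = (i1, k1).
Hypothesis place_m2 : place w m2 = (i1.+1, k1).
Hypothesis early_m2 : (m2 <= K)%N.
Hypothesis lie : deviates said m2.
Hypothesis first_lie : forall n, (n < m2)%N -> ~~ deviates said n.
Hypothesis marks : forall n, (n <= m2)%N -> marked n = (n == m1) || (n == m2).

Let lt_m : (m1 < m2)%N.
Proof.
have [//|lt_m|eq_m] := ltngtP m1 m2.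
  by have := place_lt place_m2 place_m1 lt_m; lia.
by move: place_m1; rewrite eq_m place_m2; case; lia.
Qed.

Let le_k1 : (k1 <= (width w i1).+2)%N.
Proof. by move: lie; rewrite /deviates place_m2 -widthS => /and3P[]. Qed.

(** V has announced the true letter, and both marks are at offset [k1]; so the lie leads to the test
    with both tallies equal to [k1.+1]. *)
Lemma lie_second_row j m k : (k + j)%N = k1 -> place w m = (i1.+1, k) -> (m + j)%N = m2 ->
  plays m (control_at w i1.+1 k (Some (true, history M w i1.+1 k1))) k1.+1 k.
Proof.
elim: j m k => [|j IH] m k def_k place_m def_m; apply: plays_letter.
  have eq_m : m = m2 by lia.
  have eq_k : k = k1 by lia.
  rewrite eq_m eq_k marks // eqxx orbT.
  move: lie; rewrite /deviates place_m2 => /and3P[_ le_k neq].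
  (* Up to offset [width] no end mark precedes in the row, so V takes P1's lie as it stands. *)
  have -> : true_letter (control_at w i1.+1 k1 (Some (true, history M w i1.+1 k1)))
      (scan w (minn m2.+1 (size w).+1)) (said m2) = said m2.
    rewrite /true_letter /control_at.
    by have := history_back1_some M w i1.+1 k1; rewrite le_k; case: (history_back _ _ _ _ _).
  rewrite judge_second_row (negbTE neq) /tally1 /tally2 /= addn0 addn1.
  apply: good_test.
  have := width_le (place_le place_m2 early_m2); rewrite widthS; lia.
have bound_k := place_bound place_m.
rewrite (true_said _ place_m) ?first_lie //; last by lia.
have -> : marked m = false.
  rewrite marks; last by lia.
  apply/negbTE/norP; split; apply/eqP; last by lia.
  by move=> eq_m; move: place_m; rewrite eq_m place_m1; case; lia.
rewrite judge_second_row /= faithful_row_end // ifN; last by rewrite negbK widthS; lia.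
rewrite proceed_faithful // ifT /tally1 /tally2 /=; last by rewrite widthS; lia.
rewrite addn0 addn1; apply: IH; rewrite ?(row_step place_m) ?ifT ?widthS //; lia.
Qed.

Let first_row_before m k : place w m = (i1, k) -> (m < m2)%N.
Proof.
move=> place_m; have [//|lt_m2|eq_m] := ltngtP m m2.
  by have := place_lt place_m2 place_m lt_m2; lia.
by move: place_m; rewrite eq_m place_m2; case; lia.
Qed.

Lemma lie_first_row j m k : (k + j)%N = (width w i1).+2 -> place w m = (i1, k) ->
  (m1 < m)%N ->
  plays m (control_at w i1 k (Some (false, history M w i1.+1 k1))) k1.+1 0.
Proof.
elim: j m k => [|j IH] m k def_k place_m lt_m1; apply: plays_letter;
  have lt_m2 := first_row_before place_m;
  rewrite (true_said _ place_m) ?first_lie // judge_first_row /tally1 /tally2 /= addn0;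
  rewrite proceed_faithful ?(place_bound place_m) //.
  rewrite ifN /=; last by lia.
  have place_next : place w m.+1 = (i1.+1, 0%N) by rewrite (row_step place_m) ifN //; lia.
  apply: (@lie_second_row k1) => //.
  apply: (@place_inj _ w); rewrite place_m2.
  by rewrite (place_add place_next) ?add0n // widthS; lia.
rewrite ifT /=; last by lia.
by apply: IH; rewrite ?(row_step place_m) ?ifT //; lia.
Qed.

Lemma lie_play j m i k : (m + j)%N = m1 -> place w m = (i, k) ->
  plays m (control_at w i k None) k 0.
Proof.
elim: j m i k => [|j IH] m i k def_m place_m; apply: plays_letter;
  rewrite (true_said _ place_m) ?first_lie /tally1 /tally2 /= ?addn0 ?addn1; try lia;
  have le_k := place_bound place_m.
  have eq_m : m = m1 by lia.
  move: place_m; rewrite eq_m place_m1 => -[<- <-].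
  rewrite marks; last exact: ltnW lt_m.
  rewrite eqxx judge_first_mark.
  have place_next := row_step place_m1.
  rewrite proceed_faithful //; case: ifP => lt_k /=; rewrite lt_k in place_next.
    by apply: (@lie_first_row ((width w i1).+1 - k1)) => //; lia.
  apply: (@lie_second_row k1) => //.
  apply: (@place_inj _ w); rewrite place_m2.
  by rewrite (place_add place_next) ?add0n // widthS; lia.
have -> : marked m = false.
  by rewrite marks; [apply/negbTE/norP; split; apply/eqP; lia|lia].
rewrite (judge_running place_m); last by lia.
rewrite proceed_faithful //; case: ifP => lt_k /=; apply: IH;
  rewrite ?(row_step place_m) ?lt_k //; lia.
Qed.

End Lie.
End PointingP0.
End Play.

(** * The provers *)

Section Odds.
Context {R : realType}.

Lemma half_pow_double (a : nat) : (1 / 4 : R) ^+ a = (1 / 2) ^+ a * (1 / 2) ^+ a.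
Proof. by rewrite -exprMn; congr (_ ^+ _); field. Qed.

Lemma half_pow_le (a b : nat) : (a <= b)%N -> (1 / 2 : R) ^+ b <= (1 / 2) ^+ a.
Proof. by move=> le_ab; apply: ler_wiXn2l => //; lra. Qed.

Lemma half_pow_bounds (a : nat) : 0 < (1 / 2 : R) ^+ a <= 1.
Proof. by rewrite exprn_gt0 ?exprn_ile1 //; lra. Qed.

Lemma half_pow_lt (a b : nat) : (a < b)%N -> 2 * (1 / 2 : R) ^+ b <= (1 / 2) ^+ a.
Proof.
move=> lt_ab; have := half_pow_le lt_ab; rewrite exprS.
by move: ((1 / 2) ^+ b) ((1 / 2) ^+ a) => x y; lra.
Qed.

(** Of x = 2^-a and y = 2^-b one is at least twice the other, so (x - 2y)(2x - y) >= 0, that is x^2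
    + y^2 >= (5/2)xy. P1's share is then at least 15/29. *)
Lemma odds_different (a b N : nat) (rho : R) :
  rho <= 51 / 100 -> a <> b -> (a + b <= N)%N ->
  fair_odds (7 / 16 * (1 / 2) ^+ N) rho
    (3 / 16 * ((1 / 4) ^+ a + (1 / 4) ^+ b)) (7 / 16 * (1 / 2) ^+ (a + b)).
Proof.
move=> rho_small neq_ab le_N; have := half_pow_le le_N.
have apart : 2 * (1 / 2 : R) ^+ b <= (1 / 2) ^+ a \/ 2 * (1 / 2 : R) ^+ a <= (1 / 2) ^+ b.
  by have [lt|lt|//] := ltngtP a b; [left|right]; exact: half_pow_lt.
rewrite !half_pow_double exprD.
have /andP[x0 x1] := half_pow_bounds a; have /andP[y0 y1] := half_pow_bounds b.
move: apart x0 x1 y0 y1; move: ((1 / 2) ^+ a) ((1 / 2) ^+ b) ((1 / 2) ^+ N) => x y z.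
move=> apart x0 x1 y0 y1 le_z.
have xy0 : 0 < x * y by apply: mulr_gt0.
have xy1 : x * y <= 1 by rewrite mulr_ile1 // ltW.
have xx1 : x * x <= 1 by rewrite mulr_ile1 // ltW.
have yy1 : y * y <= 1 by rewrite mulr_ile1 // ltW.
have xx0 : 0 <= x * x by rewrite mulr_ge0 // ltW.
have yy0 : 0 <= y * y by rewrite mulr_ge0 // ltW.
have sq : 5 / 2 * (x * y) <= x * x + y * y.
  have : 0 <= (x - 2 * y) * (2 * x - y).
    case: apart => ?; first by apply: mulr_ge0; lra.
    by rewrite -mulrNN; apply: mulr_ge0; lra.
  by nra.
move: xy0 xy1 xx1 yy1 xx0 yy0 sq le_z.
move: (x * y) (x * x) (y * y) => u v t *; split; try lra.
by apply: (le_trans (y := 51 / 100 * (3 / 16 * (v + t) + 7 / 16 * u))); [apply: ler_wpM2r|]; lra.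
Qed.

(** The weights are 7 to 6, and 7/13 exceeds 51/100. *)
Lemma odds_equal (a N : nat) (rho : R) :
  rho <= 51 / 100 -> (a + a <= N)%N ->
  fair_odds (7 / 16 * (1 / 2) ^+ N) rho
    (7 / 16 * (1 / 2) ^+ (a + a)) (3 / 16 * ((1 / 4) ^+ a + (1 / 4) ^+ a)).
Proof.
move=> rho_small le_N; have := half_pow_le le_N.
have /andP[] := half_pow_bounds (a + a); rewrite half_pow_double -exprD.
move: ((1 / 2) ^+ (a + a)) ((1 / 2) ^+ N) => u z u0 u1 le_z; split; try lra.
by apply: (le_trans (y := 51 / 100 * (7 / 16 * u + 3 / 16 * (u + u)))); [apply: ler_wpM2r|]; lra.
Qed.

(** The value [rho = 0] serves the inputs whose verdict goes against the prover concerned; there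
    only halting is at stake. *)
Lemma odds_verdict (N : nat) (rho : R) (v : bool) :
  rho <= 51 / 100 -> (~~ v -> rho = 0) ->
  fair_odds (7 / 16 * (1 / 2) ^+ N) rho v%:R (~~ v)%:R.
Proof.
move=> rho_small; have /andP[] := half_pow_bounds N.
move: ((1 / 2) ^+ N) => z z0 z1 rho0; split.
- exact: ler0n.
- exact: ler0n.
- by case: v {rho0} => /=; lra.
- by case: v {rho0} => /=; lra.
- by case: v rho0 => /= [_|->//]; lra.
Qed.

End Odds.

(** * The strategies of the scribe and of the pointer *)

Section Debate.
Context {A : finType} (M : TM A).

Lemma halting_place_exists w :
  (exists n, halting (tm_cur (config M w n))) -> exists T K, halting_place M w T K.
Proof.
move=> ex_halt; case: (ex_minnP ex_halt) => T halt_T min_T.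
have [_ fits _] := config_fits M w T.
have [K place_K] := @place_onto _ w T (head_at M w T) ltac:(lia).
exists T, K; split=> // j lt_jT; apply/negP => /min_T; lia.
Qed.

Lemma config_halted w T n : halting (tm_cur (config M w T)) ->
  config M w (n + T) = config M w T.
Proof.
move=> halt_T; elim: n => // n IH.
rewrite addSn [LHS]/= -/(config M w (n + T)) IH.
by case: (config M w T) halt_T => q l r /=; rewrite /halting => ->.
Qed.

Lemma halting_place_state w T K n q : halting_place M w T K -> halting q ->
  tm_cur (config M w n) = q -> tm_cur (config M w T) = q.
Proof.
case=> halt_T running _ halt_q cur_n.
have le_Tn : (T <= n)%N.
  by rewrite leqNgt; apply/negP => /running; rewrite cur_n halt_q.
by rewrite -cur_n -(subnK le_Tn) config_halted.
Qed.

Definition is_vmsg (e : event1 (debate M)) : bool := if e is VMsg _ then true else false.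

Definition rewinding (c : v_conf (debate M)) : Prop := v_cur c = Rewind M.

Lemma view1_public (e : event1 (debate M)) l : view1 (Public e :: l) = e :: view1 l.
Proof. by []. Qed.

Section Views.
Variables (p1 : prover1 (debate M)) (p0 : prover0 (debate M)) (w : seq A).
Variable log : seq (event0 (debate M)).

Let log0 := Public (VMsg (V := debate M) tt) :: log.

(** P1 is deterministic and blind to P0's marks, so its whole speech in a round is a function of its
    view at the start, and P0 can predict it. *)
Fixpoint speech_view (v : seq (event1 (debate M))) (m : nat) : seq (event1 (debate M)) :=
  if m is n.+1 then P1Msg (p1 w (speech_view v n)) :: speech_view v n else v.

Definition speech (v : seq (event1 (debate M))) (m : nat) : letter M :=
  p1 w (speech_view v m).

Lemma view_round_log m : view1 (round_log p1 p0 w log0 m) = speech_view (view1 log0) m.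
Proof. by elim: m => //= m ->. Qed.

Lemma find_speech m : find is_vmsg (speech_view (view1 log0) m) = m.
Proof. by elim: m => //= m ->. Qed.

Lemma drop_speech v m : drop m (speech_view v m) = v.
Proof. by elim: m => //=; rewrite drop0. Qed.

Lemma said_speech : said p1 p0 w log0 = speech (view1 log0).
Proof. by apply: funext => m; rewrite /said view_round_log. Qed.

Context {R : realType}.

Lemma round_of_play (good : R -> R -> Prop) i :
  plays p1 p0 w log0 good 0 (control_at w 0 0 None) 0 0 ->
  exists p q, [/\ good p q,
    round_ends (v_step p1 p0 w) (fun c => v_halted (v_cur c))
      (fun c => v_cur c == v_acc (debate M)) rewinding
      (VConf (Rewind M : v_state (debate M)) i log) p q &
    round_ends (v_step p1 p0 w) (fun c => v_halted (v_cur c))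
      (fun c => v_cur c == v_rej (debate M)) rewinding
      (VConf (Rewind M : v_state (debate M)) i log) q p].
Proof.
case=> T [p [q [win [lose [again [good_pq [win_cur lose_cur again_cur] avgE]]]]]].
have avg_round phi : avg (v_step p1 p0 w) (i.+1 + 5 + T) phi
    (VConf (Rewind M : v_state (debate M)) i log) =
    p * phi win + q * phi lose + (1 - p - q) * phi again.
  rewrite avg_add avg_round_start -avgE (start_controlE M w); apply: eq_mix => t al.
  by rewrite minnSS min0n.
have acc_rej := v_acc_rej (debate M).
exists p, q; split=> //.
  exists (i.+1 + 5 + T)%N, win, lose, again; split=> //.
  by rewrite win_cur lose_cur !haltedE eqxx; split=> //; rewrite eq_sym.
exists (i.+1 + 5 + T)%N, lose, win, again; split=> //.
  by rewrite win_cur lose_cur !haltedE eqxx; split.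
by move=> phi; rewrite avg_round; ring.
Qed.

End Views.

(** The number of events since V's last message is the index of the letter within the round. *)
Definition scribe : prover1 (debate M) := fun w v =>
  let: (i, k) := place w (find is_vmsg v) in history M w i k.

Definition first_deviation (w : seq A) (K : nat) (s : nat -> letter M) (m : nat) : bool :=
  [&& (m <= K)%N, deviates w s m & ~~ has (deviates w s) (iota 0 m)].

(** The marks fall on the first lie and on the letter above it, one row length earlier. *)
Definition points (w : seq A) (K : nat) (s : nat -> letter M) (m : nat) : bool :=
  first_deviation w K s m
  || first_deviation w K s (m + (width w (place w m).1).+3).

(** P1's current letter is already in the log, hence [j.-1]; dropping [j] events leaves P1's view at
    the start of the round. *)
Definition pointer (K : seq A -> nat) (p1 : prover1 (debate M)) : prover0 (debate M) :=
  fun w log => let j := find is_vmsg (view1 log) in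
    points w (K w) (speech p1 w (drop j (view1 log))) j.-1.

Section Strategies.
Variables (R : realType) (w : seq A) (T K : nat).
Hypothesis halts_at : halting_place M w T K.
Variable log : seq (event0 (debate M)).

Let log0 := Public (VMsg (V := debate M) tt) :: log.
Let N := (width w T + 4).*2.
Let accepted := tm_cur (config M w T) == tm_acc M.
Let delta : R := 7 / 16 * (1 / 2) ^+ N.

Lemma scribe_plays p0 (rho : R) : rho <= 51 / 100 -> (~~ accepted -> rho = 0) ->
  plays scribe p0 w log0 (fair_odds delta rho) 0 (control_at w 0 0 None) 0 0.
Proof.
move=> rho_small rho0.
apply: (honest_play halts_at _ _ _ _ (add0n K)) => //.
- by move=> m; rewrite said_speech /speech /scribe find_speech; case: place.
- by have := odds_verdict N (v := true) rho_small (fun x => match notF x with end).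
- exact: odds_verdict.
- by move=> a b neq le_N; apply: odds_different.
Qed.

Lemma marked_pointer (Ks : seq A -> nat) p1 m : Ks w = K ->
  marked p1 (pointer Ks p1) w log0 m =
  points w K (said p1 (pointer Ks p1) w log0) m.
Proof.
move=> Kw; rewrite /marked {1}/pointer Kw view1_public view_round_log said_speech.
have find_next e v : find is_vmsg (P1Msg e :: v) = (find is_vmsg v).+1 by [].
have drop_next (e : event1 (debate M)) v n : drop n.+1 (e :: v) = drop n v by [].
by rewrite find_next find_speech drop_next drop_speech.
Qed.

(** If P1 is truthful up to [K], the pointer stays silent and the verdict is the true one; otherwise
    the marks on the earliest lie force a test at equal offsets. *)
Lemma pointer_plays (Ks : seq A -> nat) p1 (rho : R) : Ks w = K ->
  rho <= 51 / 100 -> (accepted -> rho = 0) ->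
  plays p1 (pointer Ks p1) w log0 (fun p q => fair_odds delta rho q p)
    0 (control_at w 0 0 None) 0 0.
Proof.
move=> Kw rho_small rho0.
set s := said p1 (pointer Ks p1) w log0.
have verdict : fair_odds delta rho (~~ accepted)%:R accepted%:R.
  by rewrite -[accepted in X in fair_odds _ _ _ X]negbK; apply: odds_verdict => //; rewrite negbK.
have [/hasP[n]|no_lie] := boolP (has (deviates w s) (iota 0 K.+1)); last first.
  apply: (faithful_play halts_at _ (add0n K)) => // n le_nK.
  have faithful n' : (n' <= K)%N -> ~~ deviates w s n'.
    move=> le_n'; apply: contra no_lie => dev; apply/hasP; exists n' => //.
    by rewrite mem_iota add0n ltnS.
  split; first exact: faithful.
  rewrite marked_pointer // -/s /points /first_deviation; apply/norP; split.
    by apply/and3P => -[/faithful/negP].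
  by apply/and3P => -[/faithful/negP].
rewrite mem_iota add0n ltnS => /= le_nK dev_n.
have ex_dev : exists n, (n <= K)%N && deviates w s n by exists n; rewrite le_nK.
case: (ex_minnP ex_dev) => m2 /andP[le_m2 lie] min_m2.
have first_lie n' : (n' < m2)%N -> ~~ deviates w s n'.
  move=> lt_n'; apply/negP => dev; have /min_m2 : (n' <= K)%N && deviates w s n'.
    by rewrite dev andbT; lia.
  lia.
have firstE n' : first_deviation w K s n' = (n' == m2).
  apply/and3P/eqP => [[le_n' dev no_dev]|->].
    have le_m2n : (m2 <= n')%N by apply: min_m2; rewrite le_n'.
    apply/eqP; rewrite eqn_leq le_m2n andbT leqNgt; apply: contra no_dev => lt_m2.
    by apply/hasP; exists m2; rewrite // mem_iota.
  split=> //; apply/hasPn => n''; rewrite mem_iota add0n => /= /first_lie //.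
case place_m2 : (place w m2) => [[|i] k].
  by move: lie; rewrite /deviates place_m2.
have le_k : (k <= (width w i).+2)%N.
  by move: lie; rewrite /deviates place_m2 -widthS => /and3P[].
have [m1 place_m1] := place_onto le_k.
have next_m1 : m2 = (m1 + (width w i).+3)%N.
  by apply: (@place_inj _ w); rewrite place_m2 (place_next_row place_m1).
apply: (lie_play halts_at _ place_m1 place_m2 le_m2 lie first_lie _ (add0n m1)) => //.
  by move=> a le_N; apply: odds_equal.
move=> n' le_n'; rewrite marked_pointer // -/s /points !firstE orbC; congr (_ || _).
apply/eqP/eqP => [def_m2|->]; last by rewrite place_m1.
case place_n : (place w n') def_m2 => [i' k'] /= def_m2.
have := place_next_row place_n; rewrite def_m2 place_m2 => -[eq_i eq_k].
by apply: (@place_inj _ w); rewrite place_m1 place_n eq_i eq_k.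
Qed.

End Strategies.

Lemma rewinding_running c : rewinding c -> ~~ v_halted (v_cur c).
Proof. by rewrite /rewinding => ->; rewrite haltedE. Qed.

Lemma scribe_wins (R : realType) (w : seq A) T K p0 (rho : R) :
  halting_place M w T K -> 0 <= rho <= 51 / 100 ->
  (tm_cur (config M w T) != tm_acc M -> rho = 0) ->
  prob_halt R scribe p0 w = 1 /\ rho <= prob_accept R scribe p0 w.
Proof.
move=> halts_at /andP[rho_ge0 rho_small] rho0.
have /andP[pow0 pow1] := half_pow_bounds (R := R) (width w T + 4).*2.
apply: (prob_of_rounds (delta := 7 / 16 * (1 / 2) ^+ (width w T + 4).*2)
  (start := rewinding)) => //.
- by apply/andP; split; lra.
- exact: rewinding_running.
move=> [q i log]; rewrite /rewinding /= => ->.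
have [p [q' [odds ends _]]] :=
  round_of_play i (scribe_plays halts_at log p0 rho_small rho0).
by exists p, q'.
Qed.

Lemma pointer_wins (R : realType) (w : seq A) T K Ks p1 (rho : R) :
  halting_place M w T K -> Ks w = K -> 0 <= rho <= 51 / 100 ->
  (tm_cur (config M w T) == tm_acc M -> rho = 0) ->
  prob_halt R p1 (pointer Ks p1) w = 1 /\ rho <= prob_reject R p1 (pointer Ks p1) w.
Proof.
move=> halts_at Kw /andP[rho_ge0 rho_small] rho0.
have /andP[pow0 pow1] := half_pow_bounds (R := R) (width w T + 4).*2.
apply: (prob_of_rounds (delta := 7 / 16 * (1 / 2) ^+ (width w T + 4).*2)
  (start := rewinding)) => //.
- by apply/andP; split; lra.
- exact: rewinding_running.
move=> [q i log]; rewrite /rewinding /= => ->.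
have [p [q' [odds _ ends]]] :=
  round_of_play i (pointer_plays halts_at log p1 Kw rho_small rho0).
by exists q', p.
Qed.

End Debate.

Unset Implicit Arguments.

Theorem theorem3 (R : realType) (A : finType) (L : seq A -> Prop)
    (L_recursive : recursive_language L) :
  exists (V : verifier A) (eps : R),
    0 <= eps < 1 / 2 /\ competing_prover_system V L eps.
Proof.
case: L_recursive => M decides.
(* The machine halts on every input, so [T] and [K] can be chosen as functions of the input; the
   pointer uses the latter. *)
have /choice [TK halts_at] w : exists TK : nat * nat, halting_place M w TK.1 TK.2.
  have [T [K ?]] : exists T K, halting_place M w T K.
    apply: halting_place_exists.
    have [[n cur_n]|[n cur_n]] : tm_accepts M w \/ tm_rejects M w.
    - by have [acc rej] := decides w;
    case: (pselect (L w)) => Lw; [left; apply: acc|right; apply: rej].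
    - by exists n; rewrite /halting /config cur_n eqxx.
    - by exists n; rewrite /halting /config cur_n eqxx orbT.
  by exists (T, K).
have in_L w : L w -> tm_cur (config M w (TK w).1) = tm_acc M.
  move=> /(proj1 (decides w)) [n cur_n]; apply: (halting_place_state (halts_at w) _ cur_n).
  by rewrite /halting eqxx.
have not_in_L w : ~ L w -> tm_cur (config M w (TK w).1) = tm_rej M.
  move=> /(proj2 (decides w)) [n cur_n]; apply: (halting_place_state (halts_at w) _ cur_n).
  by rewrite /halting eqxx orbT.
(* Both 15/29 and 7/13 exceed 51/100 = 1 - 49/100. *)
exists (debate M), (49 / 100); split; first by apply/andP; split; lra.
have eps_rho : 1 - 49 / 100 = 51 / 100 :> R by lra.
split.
  exists (@scribe A M) => p0; split=> w.
    move=> Lw; rewrite eps_rho.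
    have [] // := scribe_wins p0 (rho := 51 / 100 : R) (halts_at w).
      by apply/andP; split; lra.
    by rewrite in_L ?eqxx.
  (* With [rho := 0] no condition on the verdict remains, which gives halting on every input. *)
  by have [] // := scribe_wins p0 (rho := 0 : R) (halts_at w); rewrite lexx /=; lra.
move=> p1; exists (pointer (fun w => (TK w).2) p1); split=> w.
  move=> nLw; rewrite eps_rho.
  have [] // := pointer_wins p1 (Ks := fun w => (TK w).2) (rho := 51 / 100 : R) (halts_at w) erefl.
    by apply/andP; split; lra.
  by rewrite not_in_L // eq_sym (negbTE (tm_acc_rej M)).
by have [] // := pointer_wins p1 (Ks := fun w => (TK w).2) (rho := 0 : R) (halts_at w) erefl;
  rewrite lexx /=; lra.
Qed.
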